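(* Let $BH_n$ denote the $n$-dimensional balanced hypercube. (1) For all integers $n,g$ with $2\le g\le 8$ and $n\ge 6-\dfrac{12}{g+1}$, the $g$-extra edge-connectivity of $BH_n$ is $$\lambda_g(BH_n)=2(g+1)n-4g+4.$$ (2) For all integers $n,g$ with $9\le g\le 2n-1$ and $n\ge \dfrac{3e_g(BH_n)}{g+1}$, $$\lambda_g(BH_n)<2(g+1)n-4g+4.$$
   Context: All graphs are finite and simple. For an integer $n\ge 1$, the $n$-dimensional balanced hypercube $BH_n$ is the graph with vertex set $\{(a_0,a_1,\ldots,a_{n-1})\mid a_i\in\{0,1,2,3\},\ 0\le i\le n-1\}$, in which each vertex $(a_0,a_1,\ldots,a_{n-1})$ has exactly the following $2n$ neighbors: (1) the two vertices $((a_0\pm1)\bmod 4,\,a_1,\ldots,a_{n-1})$; and (2) for each $i$ with $1\le i\le n-1$, the two vertices $((a_0\pm1)\bmod 4,\,a_1,\ldots,a_{i-1},\,(a_i+(-1)^{a_0})\bmod 4,\,a_{i+1},\ldots,a_{n-1})$. An edge-cut of a connected graph $G$ is a set $F\subseteq E(G)$ such that $G-F$ (delete the edges of $F$, keep all vertices) is disconnected. For a nonnegative integer $g$, an edge-cut $F$ is a $g$-extra edge-cut if every component of $G-F$ has at least $g+1$ vertices. The $g$-extra edge-connectivity $\lambda_g(G)$ is the minimum cardinality of a $g$-extra edge-cut of $G$, if one exists. For a graph $G$ with at least $g+1$ vertices, $e_g(G)=\max\{|E(G[U])| : U\subseteq V(G),\ |U|=g+1\}$, where $G[U]$ is the subgraph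 of $G$ induced by $U$. *)

(* Defs.v *)
From HB Require Import structures.
From mathcomp Require Import all_boot all_order all_algebra.

Set Implicit Arguments.
Unset Strict Implicit.
Unset Printing Implicit Defensive.

Import Order.TTheory GRing.Theory Num.Theory.
Local Open Scope ring_scope.

Record sgraph := SGraph {
  svertex :> finType;
  adj : rel svertex;
  adj_sym : symmetric adj;
  adj_irr : irreflexive adj
}.

Definition edges (G : sgraph) : {set {set G}} :=
  [set [set p.1; p.2] | p : G * G & adj p.1 p.2].

Definition edges_in (G : sgraph) (U : {set G}) : {set {set G}} :=
  [set f in edges G | f \subset U].

Definition del_adj (G : sgraph) (F : {set {set G}}) : rel G :=
  fun x y => adj x y && ([set x; y] \notin F).

Lemma del_adj_sym (G : sgraph) (F : {set {set G}}) : symmetric (del_adj F).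
Proof. by move=> x y; rewrite /del_adj adj_sym setUC. Qed.

Lemma del_adj_irr (G : sgraph) (F : {set {set G}}) : irreflexive (del_adj F).
Proof. by move=> x; rewrite /del_adj adj_irr. Qed.

Definition del_edges (G : sgraph) (F : {set {set G}}) : sgraph :=
  SGraph (del_adj_sym F) (del_adj_irr F).

Definition component (G : sgraph) (x : G) : {set G} :=
  [set y | connect (@adj G) x y].

Definition components (G : sgraph) : {set {set G}} :=
  [set component x | x : G].

Definition connected (G : sgraph) : bool :=
  [forall x : G, forall y : G, connect (@adj G) x y].

Definition edge_cut (G : sgraph) (F : {set {set G}}) : bool :=
  (F \subset edges G) && ~~ connected (del_edges F).

Definition extra_edge_cut (G : sgraph) (g : nat) (F : {set {set G}}) : bool :=
  edge_cut F && [forall C in components (del_edges F), (g.+1 <= #|C|)%N].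

(* [None] when G has no g-extra edge-cut *)
Definition extra_edge_connectivity (G : sgraph) (g : nat) : option nat :=
  if [pick F : {set {set G}} | extra_edge_cut g F] is Some F0
  then Some #|[arg min_(F < F0 | extra_edge_cut g F) #|F|]|
  else None.

(* The maximum is 0 when G has fewer than g + 1 vertices. *)
Definition max_induced_edges (G : sgraph) (g : nat) : nat :=
  \max_(U : {set G} | #|U| == g.+1) #|edges_in U|.

(* With s = 1 or s = -1: the neighbor of a that moves only a_0 when i = 0, and
   a_0 and a_i when 0 < i < n. *)
Definition bh_nbr (n : nat) (a : n.-tuple 'Z_4) (s : 'Z_4) (i : 'I_n) :
    n.-tuple 'Z_4 :=
  [tuple if j == 0%N :> nat then a`_0 + s
         else if j == i then a`_j + (-1) ^+ (a`_0)%R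
         else a`_j | j < n].

Definition bh_adj (n : nat) : rel (n.-tuple 'Z_4) := fun a b =>
  [exists i : 'I_n, (b == bh_nbr a 1 i) || (b == bh_nbr a (-1) i)].

Lemma bh_nbr_nth n (a : n.-tuple 'Z_4) (s : 'Z_4) (i j : 'I_n) :
  (bh_nbr a s i)`_j =
  if j == 0%N :> nat then a`_0 + s
  else if j == i then a`_j + (-1) ^+ (a`_0)%R else a`_j.
Proof. by rewrite -tnth_nth tnth_mktuple. Qed.

Lemma bh_nbr_nth0 n (a : n.-tuple 'Z_4) s i : (bh_nbr a s i)`_0 = a`_0 + s.
Proof.
have n_gt0 : (0 < n)%N by apply: leq_ltn_trans (ltn_ord i).
by rewrite (bh_nbr_nth a s i (Ordinal n_gt0)).
Qed.

Lemma bh_nbrK n (a : n.-tuple 'Z_4) s i :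
  (s == 1) || (s == -1) -> bh_nbr (bh_nbr a s i) (- s) i = a.
Proof.
move=> s1; apply: eq_from_tnth => j; rewrite !(tnth_nth 0) bh_nbr_nth.
case: ifP => [/eqP -> | j0]; first by rewrite bh_nbr_nth0 addrK.
rewrite bh_nbr_nth0 bh_nbr_nth j0; case: (j == i) => //.
rewrite -addrA -[RHS]addr0; congr (_ + _).
case/orP: s1 => /eqP->; case: (a`_0) => [[|[|[|[|]]]]] // ?; exact: val_inj.
Qed.

Lemma bh_adj_sym n : symmetric (@bh_adj n).
Proof.
suff sub (a b : n.-tuple 'Z_4) : bh_adj a b -> bh_adj b a.
  by move=> a b; apply/idP/idP; apply: sub.
case/existsP=> i /orP[] /eqP->; apply/existsP; exists i.
  by rewrite -{3}(@bh_nbrK n a 1 i) ?eqxx ?orbT.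
by rewrite -{1}(@bh_nbrK n a (-1) i) ?opprK ?eqxx ?orbT.
Qed.

Lemma bh_adj_irr n : irreflexive (@bh_adj n).
Proof.
move=> a; apply/existsP => -[i] /orP[] /eqP.
  by move/(congr1 (fun t : n.-tuple _ => t`_0))/eqP;
     rewrite bh_nbr_nth0 addrC -subr_eq subrr.
by move/(congr1 (fun t : n.-tuple _ => t`_0))/eqP;
   rewrite bh_nbr_nth0 addrC -subr_eq subrr.
Qed.

Definition BH (n : nat) : sgraph := SGraph (@bh_adj_sym n) (@bh_adj_irr n).

(* Main.v *)
Require Import Defs.
From HB Require Import structures.
From mathcomp Require Import all_boot all_order all_algebra.
From mathcomp Require Import zify.

Set Implicit Arguments.
Unset Strict Implicit.
Unset Printing Implicit Defensive.

Import Order.TTheory GRing.Theory Num.Theory.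

(** Write bd X for the number of edges leaving X, so that bd X = 2n|X| - 2 e(X).
   The vertices a and a + (2,0,...,0) are twins (they have the same neighbors),
   and the common neighbors of two vertices that are neither equal nor twins lie
   in a single pair of twins.  Hence a set of minimum inner degree d >= 3 has at
   least 4(d-1) vertices, and removing vertices of small degree one by one gives
   e(X) <= 2|X| - 4 for 3 <= |X| <= 9 and e(X) <= 4|X| - 22 for 9 <= |X| <= 15.

   Lower bound: with t = 3, 4, 6, 9 for n = 2, 3, 4, >= 5, every X with
   t <= |X| <= 4^n - t has bd X >= 2t(n-2) + 8.  By induction on n, BH_n is cut
   into the four copies of BH_(n-1) given by the last coordinate; if |X| is at
   most half of the vertices, then either two slices of X are of intermediate
   size, or a nearly empty slice lies next to a nearly full one (which costs at
   least 4^(n-1) edges), or exactly one slice Y is of intermediate size and the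
   others are nearly empty (bd X >= bd Y + 2|Y|), or all slices are small.

   Upper bound: the boundary of the complete bipartite graph K_(2,g-1), made of a
   pair of twins and common neighbors, and for g >= 9 of a set that starts from
   ten vertices over a hexagon, spanning 17 instead of 16 edges.  A vertex
   outside such a set has at most n neighbors in it, so outside components have
   minimum degree at least n and, being bipartite, at least 2n > g vertices. *)

Local Open Scope ring_scope.

(** * Parity classes, twins and common neighbors *)

Definition parity n (a : n.-tuple 'Z_4) : bool := odd (a`_0 : 'Z_4)%R.

Definition twin n (a : n.-tuple 'Z_4) : n.-tuple 'Z_4 :=
  [tuple if j == 0%N :> nat then a`_0 + 2 else a`_j | j < n].

Lemma odd_Z4D1 (x s : 'Z_4) : (s == 1) || (s == -1) -> odd (x + s)%R = ~~ odd x.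
Proof. by case/orP=> /eqP->; case: x => [[|[|[|[|]]]]]. Qed.

Lemma bh_adjP n (a b : n.-tuple 'Z_4) :
  reflect (exists s i, (s == 1) || (s == -1) /\ b = bh_nbr a s i) (bh_adj a b).
Proof.
apply: (iffP existsP) => [[i /orP[]/eqP->]|[s [i [/orP[]/eqP-> ->]]]].
- by exists 1, i; rewrite eqxx.
- by exists (-1), i; rewrite eqxx orbT.
- by exists i; rewrite eqxx.
- by exists i; rewrite eqxx orbT.
Qed.

Lemma bh_adj_parity n (a b : n.-tuple 'Z_4) : bh_adj a b -> parity b = ~~ parity a.
Proof. by case/bh_adjP => s [i [s1 ->]]; rewrite /parity bh_nbr_nth0 odd_Z4D1. Qed.

Lemma twin_nth n (a : n.-tuple 'Z_4) (j : 'I_n) :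
  (twin a)`_j = if j == 0%N :> nat then a`_0 + 2 else a`_j.
Proof. by rewrite -tnth_nth tnth_mktuple. Qed.

Lemma twin_nth0 n (a : n.-tuple 'Z_4) : (0 < n)%N -> (twin a)`_0 = a`_0 + 2.
Proof. by move=> n_gt0; rewrite (twin_nth a (Ordinal n_gt0)). Qed.

Lemma tuple_eq0 n (a b : n.-tuple 'Z_4) : n = 0%N -> a = b.
Proof. by move=> n0; subst n; rewrite tuple0 [b]tuple0. Qed.

Lemma parity_twin n (a : n.-tuple 'Z_4) : parity (twin a) = parity a.
Proof.
case: (posnP n) => [n0|n_gt0]; first by rewrite (tuple_eq0 (twin a) a n0).
by rewrite /parity twin_nth0 //; case: (a`_0) => [[|[|[|[|]]]]].
Qed.

Lemma twinK n : involutive (@twin n).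
Proof.
move=> a; apply: eq_from_tnth => j; rewrite !(tnth_nth 0) !twin_nth.
have n_gt0 : (0 < n)%N by apply: leq_ltn_trans (ltn_ord j).
case: eqP => // ->; rewrite twin_nth0 //.
by case: (a`_0) => [[|[|[|[|]]]]] // ?; apply: val_inj.
Qed.

Lemma twin_neq n (a : n.-tuple 'Z_4) : (0 < n)%N -> twin a != a.
Proof.
move=> n_gt0; apply/eqP => /(congr1 (fun t : n.-tuple _ => t`_0)) /eqP.
by rewrite twin_nth0 //; case: (a`_0) => [[|[|[|[|]]]]].
Qed.

Lemma parity_twin_eq n (a b : n.-tuple 'Z_4) :
    parity a = parity b ->
    (forall j : 'I_n, j != 0%N :> nat -> a`_j = b`_j) -> (b == a) || (b == twin a).
Proof.
move=> pab eqab; case: (posnP n) => [n0|n_gt0]; first by rewrite (tuple_eq0 b a n0) eqxx.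
have : (b`_0 == a`_0) || (b`_0 == a`_0 + 2).
  by move: pab; rewrite /parity; case: (a`_0) => [[|[|[|[|]]]]] // ?;
     case: (b`_0) => [[|[|[|[|]]]]].
case/orP=> /eqP b0; apply/orP; [left|right]; apply/eqP;
  apply: eq_from_tnth => j; rewrite !(tnth_nth 0) ?twin_nth;
  case: (eqVneq (j : nat) 0%N) => [->|j0] //; by rewrite eqab.
Qed.

(** Adding 2 to a_0 keeps the sign (-1)^(a_0), and since 2s = 2 in Z_4 for s = 1 or -1, the step -s
    from the twin ends where the step s from the vertex ends. *)
Lemma bh_adj_twin n (a b : n.-tuple 'Z_4) : bh_adj (twin a) b = bh_adj a b.
Proof.
suff sub c d : @bh_adj n c d -> bh_adj (twin c) d.
  by apply/idP/idP; [rewrite -{2}(twinK a)|]; apply: sub.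
case/bh_adjP => s [i [s1 ->]]; apply/bh_adjP; exists (- s), i; split.
  by case/orP: s1 => /eqP->.
have n_gt0 : (0 < n)%N by apply: leq_ltn_trans (ltn_ord i).
apply: eq_from_tnth => j; rewrite !(tnth_nth 0) !bh_nbr_nth twin_nth0 // twin_nth.
case: (eqVneq (j : nat) 0%N) => [_|_].
  by case/orP: s1 => /eqP->; case: (c`_0) => [[|[|[|[|]]]]] // ?; apply: val_inj.
case: eqP => // _; congr (_ + _).
by case: (c`_0) => [[|[|[|[|]]]]] // ?; apply: val_inj.
Qed.

Lemma sign_parity n (a : n.-tuple 'Z_4) :
  (-1) ^+ (a`_0)%R = (if parity a then -1 else 1) :> 'Z_4.
Proof. by rewrite /parity; case: (a`_0) => [[|[|[|[|]]]]] // ?; apply: val_inj. Qed.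

Lemma bh_adj_nth n (a b : n.-tuple 'Z_4) : bh_adj a b ->
  exists i : 'I_n, forall j : 'I_n, j != 0%N :> nat ->
    b`_j = if j == i then a`_j + (if parity a then -1 else 1) else a`_j.
Proof.
case/bh_adjP => s [i [_ ->]]; exists i => j j0.
by rewrite bh_nbr_nth (negbTE j0) sign_parity.
Qed.

(* In Z_4 the differences u_i' - u_i (with u_0 = 0) determine i and i'. *)
Lemma bh_common n (x y z w : n.-tuple 'Z_4) :
    bh_adj x z -> bh_adj y z -> bh_adj x w -> bh_adj y w ->
  [|| y == x, y == twin x, w == z | w == twin z].
Proof.
move=> xz yz xw yw.
have pxz := bh_adj_parity xz; have pyz := bh_adj_parity yz.
have pxw := bh_adj_parity xw.
have pxy : parity x = parity y by move: pyz; rewrite pxz; apply: negb_inj.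
have pzw : parity z = parity w by rewrite pxz.
case: (bh_adj_nth xz) => i xzi; case: (bh_adj_nth yz) => i' yzi.
case: (bh_adj_nth xw) => k xwk; case: (bh_adj_nth yw) => k' ywk.
rewrite -pxy in yzi ywk.
have E4 (u v s : 'Z_4) : u + s = v + s -> u = v by apply: addIr.
case: (eqVneq i i') => [ii'|ii'].
  suff: (y == x) || (y == twin x) by case/orP => ->; rewrite ?orbT.
  apply: parity_twin_eq => // j j0; have := yzi j j0; rewrite (xzi j j0) -ii'.
  by case: ifP => // _; apply: E4.
case: (eqVneq k k') => [kk'|kk'].
  suff: (y == x) || (y == twin x) by case/orP => ->; rewrite ?orbT.
  apply: parity_twin_eq => // j j0; have := ywk j j0; rewrite (xwk j j0) -kk'.
  by case: ifP => // _; apply: E4.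
suff: (w == z) || (w == twin z) by case/orP => ->; rewrite ?orbT.
apply: parity_twin_eq => // j j0; rewrite (xzi j j0) (xwk j j0).
have := yzi j j0; rewrite (xzi j j0); have := ywk j j0; rewrite (xwk j j0).
(* If j equals exactly one of i and k, the two expressions of y_j through z and w give s = 0 or 2s =
   0 up to sign, where s = 1 or -1 is the common sign; neither holds in Z_4. *)
case: (eqVneq j i) => [->|ji]; case: (eqVneq _ k) => [E|jk] //; move: E4 => _.
  rewrite (negbTE ii') => xk' xi; move: xk' => /eqP; rewrite -xi.
  by case: (i == k'); case: (parity x); case: (x`_i) => [[|[|[|[|]]]]].
rewrite E (negbTE kk') => <- /eqP.
by case: (k == i'); case: (parity x); case: (x`_k) => [[|[|[|[|]]]]].
Qed.

Lemma bh_degree n (a : n.-tuple 'Z_4) : #|[set b | bh_adj a b]| = (2 * n)%N.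
Proof.
pose f (p : bool * 'I_n) := bh_nbr a (if p.1 then 1 else -1) p.2.
have -> : [set b | bh_adj a b] = f @: setT.
  apply/setP => b; rewrite inE; apply/bh_adjP/imsetP.
    case=> s [i [/orP[]/eqP-> ->]]; first by exists (true, i).
    by exists (false, i).
  case=> -[u i] _ ->; exists (if u then 1 else -1), i; split => //.
  by case: u; rewrite eqxx ?orbT.
rewrite card_imset ?cardsT ?card_prod ?card_bool ?card_ord //.
move=> [u i] [v k] /= /(congr1 (fun t : n.-tuple _ => (t : seq _))) E.
have E' j := congr1 (fun t => t`_j) E; rewrite /f /= in E'.
have := E' 0%N; rewrite !bh_nbr_nth0 => /addrI uv.
have {uv} uv : u = v by move: uv; clear; case: u; case: v => // /eqP.
congr (_, _) => //; apply/eqP; apply/idPn => ik.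
have {E'} E' (j : 'I_n) : j != 0%N :> nat -> (j == i) = (j == k).
  move=> j0; have := E' j; rewrite !bh_nbr_nth (negbTE j0) sign_parity.
  case: eqP => _; case: eqP => _ // /eqP; case: (a`_j) => [[|[|[|[|]]]]] //;
  by case: (parity a).
(* A nonzero index is visible in its own coordinate, and two indices that leave no such trace are
   both 0. *)
case: (eqVneq (i : nat) 0%N) => i0; last first.
  by have := E' i i0; rewrite eqxx (negbTE ik).
case: (eqVneq (k : nat) 0%N) => k0.
  by case/eqP: ik; apply: val_inj; rewrite /= i0 k0.
by have := E' k k0; rewrite eqxx eq_sym (negbTE ik).
Qed.

Local Close Scope ring_scope.

(** * Inner degrees and edge boundaries *)

Definition inner_nbrs n (X : {set n.-tuple 'Z_4}) (x : n.-tuple 'Z_4) :=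
  [set y in X | bh_adj x y].

(* Twice the number of edges inside [X]. *)
Definition degsum n (X : {set n.-tuple 'Z_4}) := \sum_(x in X) #|inner_nbrs X x|.

Definition boundary n (X : {set n.-tuple 'Z_4}) := \sum_(x in X) #|inner_nbrs (~: X) x|.

Lemma nbrsE n (X : {set n.-tuple 'Z_4}) x : inner_nbrs X x = X :&: [set y | bh_adj x y].
Proof. by apply/setP => y; rewrite !inE. Qed.

Lemma card_nbrs n (X : {set n.-tuple 'Z_4}) x :
  #|inner_nbrs X x| = \sum_(y in X) bh_adj x y.
Proof.
rewrite -sum1_card big_mkcond [RHS]big_mkcond; apply: eq_bigr => y _.
by rewrite inE; case: (y \in X); case: bh_adj.
Qed.

Lemma card_nbrsC n (X : {set n.-tuple 'Z_4}) x :
  #|inner_nbrs X x| + #|inner_nbrs (~: X) x| = 2 * n.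
Proof.
by rewrite !nbrsE setIC [~: X :&: _]setIC -setDE -(bh_degree x) cardsID.
Qed.

Lemma boundary_degsum n (X : {set n.-tuple 'Z_4}) :
  boundary X + degsum X = 2 * n * #|X|.
Proof.
rewrite /boundary /degsum -big_split /= mulnC -sum_nat_const.
by apply: eq_bigr => x _; rewrite addnC card_nbrsC.
Qed.

Lemma boundaryC n (X : {set n.-tuple 'Z_4}) : boundary (~: X) = boundary X.
Proof.
rewrite /boundary setCK; under eq_bigr do rewrite card_nbrs.
rewrite exchange_big /=; apply: eq_bigr => x _; rewrite card_nbrs.
by apply: eq_bigr => y _; rewrite bh_adj_sym.
Qed.

(** Besides the degree of x itself, each inner neighbor of x loses one. *)
Lemma degsum_rem n (X : {set n.-tuple 'Z_4}) x : x \in X ->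
  degsum X = degsum (X :\ x) + 2 * #|inner_nbrs X x|.
Proof.
move=> xX; rewrite /degsum (big_setD1 x) //=.
have -> : \sum_(y in X :\ x) #|inner_nbrs X y| =
          \sum_(y in X :\ x) (#|inner_nbrs (X :\ x) y| + bh_adj y x).
  by apply: eq_bigr => y _; rewrite !card_nbrs (big_setD1 x) //= addnC.
have nx : #|inner_nbrs X x| = \sum_(y in X :\ x) bh_adj x y.
  by rewrite card_nbrs (big_setD1 x) //= bh_adj_irr.
rewrite big_split /= nx; under [X in _ + (_ + X)]eq_bigr do rewrite bh_adj_sym.
by rewrite mul2n -addnn [LHS]addnC -addnA.
Qed.

(** * Parity parts, minimum degree and the number of edges in small sets *)

Definition part n (b : bool) (X : {set n.-tuple 'Z_4}) := [set x in X | parity x == b].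

Lemma card_part n (X : {set n.-tuple 'Z_4}) :
  #|part true X| + #|part false X| = #|X|.
Proof.
have PE c : part c X = X :&: [set x | parity x == c] by apply/setP => x; rewrite !inE.
rewrite !PE -(cardsID [set x | parity x == true] X); congr (_ + #|pred_of_set _|).
by apply/setP => x; rewrite !inE; case: (x \in X); case: (parity x).
Qed.

Lemma nbrs_parts n (X : {set n.-tuple 'Z_4}) x :
  inner_nbrs X x \subset part (~~ parity x) X.
Proof.
by apply/subsetP => y; rewrite !inE => /andP[-> /bh_adj_parity ->]; rewrite eqxx.
Qed.

Lemma degsum_le_parts n (X : {set n.-tuple 'Z_4}) :
  degsum X <= 2 * (#|part true X| * #|part false X|).
Proof.
rewrite /degsum (bigID (fun x => parity x)) /= mul2n -addnn leq_add //.
  rewrite -sum_nat_const; under [X in _ <= X]eq_bigl do rewrite inE eqb_id.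
  apply: leq_sum => x /andP[_ px]; apply: leq_trans (subset_leq_card (nbrs_parts X x)) _.
  by rewrite px.
rewrite mulnC -sum_nat_const; under [X in _ <= X]eq_bigl do rewrite inE eqbF_neg.
apply: leq_sum => x /andP[_ px]; apply: leq_trans (subset_leq_card (nbrs_parts X x)) _.
by rewrite (negbTE px).
Qed.

Lemma nbrsI_sub n (X : {set n.-tuple 'Z_4}) (x y z : n.-tuple 'Z_4) :
    y != x -> y != twin x -> bh_adj x z -> bh_adj y z ->
  inner_nbrs X x :&: inner_nbrs X y \subset [set z; twin z].
Proof.
move=> yx ytx xz yz; apply/subsetP => w; rewrite !inE.
case/andP => /andP[_ xw] /andP[_ yw].
by have := bh_common xz yz xw yw; rewrite (negbTE yx) (negbTE ytx).
Qed.

Lemma card_nbrsI n (X : {set n.-tuple 'Z_4}) (x y : n.-tuple 'Z_4) :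
    y != x -> y != twin x -> #|inner_nbrs X x :&: inner_nbrs X y| <= 2.
Proof.
move=> yx ytx; case: (set_0Vmem (inner_nbrs X x :&: inner_nbrs X y)) => [->|[z]].
  by rewrite cards0.
rewrite !inE => /andP[/andP[_ xz] /andP[_ yz]].
apply: leq_trans (subset_leq_card (nbrsI_sub X yx ytx xz yz)) _.
by rewrite cards2; case: eqP.
Qed.

Lemma exists_nontwin n (S : {set n.-tuple 'Z_4}) x : 2 < #|S| ->
  exists2 y, y \in S & (y != x) && (y != twin x).
Proof.
move=> S3; apply/exists_inP; apply/contraT; rewrite negb_exists => /forallP h.
have : S \subset [set x; twin x].
  apply/subsetP => y yS; move: (h y); rewrite yS /= !inE.
  by case: (y == x); case: (y == twin x).
by move/subset_leq_card; rewrite cards2 => /(leq_trans S3); case: eqP.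
Qed.

(** Two neighbors y and z of x in X that are neither equal nor twins exist because d > 2. Each has
    at least d neighbors in X, all of the parity of x, and they share at most 2. *)
Lemma min_degree_part n (X : {set n.-tuple 'Z_4}) d x : x \in X -> 2 < d ->
    (forall y, y \in X -> d <= #|inner_nbrs X y|) ->
  2 * d - 2 <= #|part (parity x) X|.
Proof.
move=> xX d3 dX; have dx := dX x xX.
have [y] : exists y, y \in inner_nbrs X x by apply/card_gt0P; lia.
rewrite inE => /andP[yX xy].
have [z] := exists_nontwin y (leq_trans d3 dx); rewrite inE => /andP[zX xz] /andP[zy zty].
have := cardsUI (inner_nbrs X y) (inner_nbrs X z); have := dX y yX; have := dX z zX.
have := card_nbrsI X zy zty.
have : #|inner_nbrs X y :|: inner_nbrs X z| <= #|part (parity x) X|.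
  apply: subset_leq_card; rewrite subUset.
  have := nbrs_parts X y; have := nbrs_parts X z.
  by rewrite (bh_adj_parity xy) (bh_adj_parity xz) negbK => -> ->.
lia.
Qed.

Lemma min_degree_parts n (X : {set n.-tuple 'Z_4}) d b : X != set0 -> 2 < d ->
    (forall y, y \in X -> d <= #|inner_nbrs X y|) ->
  2 * d - 2 <= #|part b X|.
Proof.
case/set0Pn => x xX d3 dX.
case: (eqVneq (parity x) b) => [<-|xb]; first exact: min_degree_part dX.
have [y] : exists y, y \in inner_nbrs X x by apply/card_gt0P; have := dX x xX; lia.
rewrite inE => /andP[yX xy].
have -> : b = parity y by rewrite (bh_adj_parity xy); case: b xb; case: (parity x).
exact: min_degree_part dX.
Qed.

Lemma min_degree_card n (X : {set n.-tuple 'Z_4}) d : X != set0 -> 2 < d ->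
    (forall y, y \in X -> d <= #|inner_nbrs X y|) ->
  4 * d - 4 <= #|X|.
Proof.
move=> X0 d3 dX; rewrite -(card_part X).
have := min_degree_parts true X0 d3 dX; have := min_degree_parts false X0 d3 dX.
lia.
Qed.

Lemma exists_degree_lt n (X : {set n.-tuple 'Z_4}) d : X != set0 -> 2 < d ->
  #|X| < 4 * d - 4 -> exists2 x, x \in X & #|inner_nbrs X x| < d.
Proof.
move=> X0 d3 Xd; apply/exists_inP/contraT; rewrite negb_exists => /forallP h.
have /(min_degree_card X0 d3) : forall y, y \in X -> d <= #|inner_nbrs X y|.
  by move=> y yX; move: (h y); rewrite yX /= -leqNgt.
lia.
Qed.

(* In a part of four vertices any two non-twin opposite vertices share exactly
   a twin pair, so the part is a union of two twin pairs and every opposite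
   vertex is adjacent to all of it. *)
Lemma min_degree3_part n (X : {set n.-tuple 'Z_4}) b : X != set0 ->
    (forall y, y \in X -> 2 < #|inner_nbrs X y|) -> #|part b X| <> 4.
Proof.
move=> X0 dX E4.
have nE o : parity o = ~~ b -> inner_nbrs X o \subset part b X.
  by move=> po; have := nbrs_parts X o; rewrite po negbK.
have two e : e \in part b X -> exists o1 o2,
    [/\ o1 \in X, o2 \in X, bh_adj o1 e, bh_adj o2 e &
        [/\ parity o1 = ~~ b, parity o2 = ~~ b, o2 != o1 & o2 != twin o1]].
  rewrite inE => /andP[eX /eqP pe].
  have [o1] : exists o, o \in inner_nbrs X e by apply/card_gt0P; have := dX e eX; lia.
  rewrite inE => /andP[o1X eo1].
  have [o2] := exists_nontwin o1 (dX e eX); rewrite inE => /andP[o2X eo2] /andP[h1 h2].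
  exists o1, o2; split; rewrite ?(bh_adj_sym _ e) //.
  by rewrite (bh_adj_parity eo1) (bh_adj_parity eo2) pe.
have share o1 o2 : o1 \in X -> o2 \in X -> parity o1 = ~~ b -> parity o2 = ~~ b ->
    #|inner_nbrs X o1| + #|inner_nbrs X o2| <= 4 + #|inner_nbrs X o1 :&: inner_nbrs X o2|.
  move=> o1X o2X p1 p2; rewrite -cardsUI leq_add2r; apply: leq_trans (eq_leq E4).
  by rewrite subset_leq_card // subUset !nE.
have twE e : e \in part b X -> twin e \in part b X.
  move=> eE; have [o1 [o2 [o1X o2X a1 a2 [p1 p2 h1 h2]]]] := two e eE.
  have s := share o1 o2 o1X o2X p1 p2.
  have sub := nbrsI_sub X h1 h2 a1 a2.
  (* If [twin e] were not adjacent to o1 within X, then o1 and o2 would share only e, and 3 + 3 <= 4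
     + 1 would follow from [share]. *)
  have [tn|] := boolP (twin e \in inner_nbrs X o1); first exact: (subsetP (nE o1 p1)).
  move=> tn; have : inner_nbrs X o1 :&: inner_nbrs X o2 \subset [set e].
    apply/subsetP => w wI; have := subsetP sub w wI; rewrite !inE => /orP[//|/eqP wt].
    by move: wI; rewrite wt inE (negbTE tn).
  move/subset_leq_card; rewrite cards1 => c1.
  have d1 := dX o1 o1X; have d2 := dX o2 o2X.
  have := leq_trans (leq_add d1 d2) (leq_trans s (leq_add (leqnn 4) c1)).
  by rewrite addn1.
have [e eE] : exists e, e \in part b X by apply/card_gt0P; rewrite E4.
have [o1 [o2 [o1X o2X a1 a2 [p1 p2 h1 h2]]]] := two e eE.
have [f] := exists_nontwin e (dX o1 o1X); rewrite inE => /andP[fX a1f] /andP[fe fte].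
have n_gt0 : 0 < n.
  by case: (posnP n) => // n0; move: fe; rewrite (tuple_eq0 f e n0) eqxx.
have inE' u : u \in part b X -> bh_adj o1 u -> u \in inner_nbrs X o1.
  by rewrite !inE => /andP[->].
have a1t u : bh_adj o1 u -> bh_adj o1 (twin u) by rewrite !(bh_adj_sym o1) bh_adj_twin.
have fE : f \in part b X by rewrite (subsetP (nE o1 p1)) // inE fX.
have s := share o1 o2 o1X o2X p1 p2; have c2 := card_nbrsI X h1 h2; have d2 := dX o2 o2X.
(* With four neighbors of o1, at least three of o2 and at most two shared, [share] would give 4 + 3
   <= 4 + 2. *)
suff n4 : 4 <= #|inner_nbrs X o1|.
  by have := leq_trans (leq_add n4 d2) (leq_trans s (leq_add (leqnn 4) c2)).
pose Q := [set e; twin e; f; twin f].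
have cQ : #|Q| = 4.
  have et : (e == twin f) = false by apply: contraNF fte => /eqP ->; rewrite twinK.
  have tt : (twin e == twin f) = false.
    by apply: contraNF fe => /eqP tfe; rewrite -(twinK f) -tfe twinK.
  rewrite /Q -!setUA !cardsU1 cards1 !inE et tt (eq_sym e) (negbTE (twin_neq e n_gt0)).
  rewrite (eq_sym e) (negbTE fe) (eq_sym (twin e)) (negbTE fte).
  by rewrite (eq_sym f) (negbTE (twin_neq f n_gt0)).
apply: leq_trans (eq_leq (esym cQ)) _.
apply: subset_leq_card; apply/subsetP => u; rewrite !in_setU !in_set1.
by case/orP => [/orP[/orP[]|]|] /eqP ->; apply: inE'; rewrite ?twE ?a1t.
Qed.

(** Minimum degree 3 forces at least 4 vertices in each parity part, and exactly 4 is impossible, so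
    X would have at least 10 vertices. *)
Lemma exists_degree_le2 n (X : {set n.-tuple 'Z_4}) : X != set0 -> #|X| <= 9 ->
  exists2 x, x \in X & #|inner_nbrs X x| <= 2.
Proof.
move=> X0 X9; apply/exists_inP/contraT; rewrite negb_exists => /forallP h.
have dX : forall y, y \in X -> 2 < #|inner_nbrs X y|.
  by move=> y yX; move: (h y); rewrite yX /= -ltnNge.
have := min_degree3_part (b := true) X0 dX.
have := min_degree3_part (b := false) X0 dX.
have := min_degree_parts true X0 (leqnn 3) dX.
have := min_degree_parts false X0 (leqnn 3) dX.
have := card_part X; lia.
Qed.

(** Up to four vertices, the product of the part sizes suffices. Beyond that, a vertex of inner
    degree at most 2 is removed, which lowers the degree sum by at most 4. *)
Lemma degsum_le9 n (X : {set n.-tuple 'Z_4}) : 3 <= #|X| <= 9 ->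
  degsum X + 8 <= 4 * #|X|.
Proof.
move: {2}#|X| (leqnn #|X|) => m; elim: m X => [|m IH] X Xm /andP[X3 X9]; first lia.
case: (leqP #|X| 4) => X4.
  have := degsum_le_parts X; have := card_part X.
  move: #|part true X| #|part false X| => p q pq h.
  rewrite -pq in X3 X4 *; apply: leq_trans (_ : 2 * (p * q) + 8 <= _); first lia.
  clear -X3 X4.
  by case: p X3 X4 => [|[|[|[|[|p]]]]]; case: q => [|[|[|[|[|q]]]]]; lia.
have X0 : X != set0 by rewrite -card_gt0; lia.
have [x xX dx] := exists_degree_le2 X0 X9.
have cX : #|X| = #|X :\ x|.+1 by rewrite (cardsD1 x) xX.
have := IH (X :\ x); rewrite (degsum_rem xX); lia.
Qed.

Lemma degsum_le4 n (X : {set n.-tuple 'Z_4}) : #|X| <= 9 -> degsum X <= 4 * #|X|.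
Proof.
move=> X9; case: (leqP 3 #|X|) => X3; first by have := @degsum_le9 _ X; lia.
have := degsum_le_parts X; have := card_part X.
move: #|part true X| #|part false X| => p q pq h.
apply: leq_trans h _; case: p pq => [|[|[|p]]] pq; nia.
Qed.

Lemma degsum_le2 n (X : {set n.-tuple 'Z_4}) : #|X| <= 3 -> degsum X <= 2 * #|X|.
Proof.
have := degsum_le_parts X; have := card_part X.
move: #|part true X| #|part false X| => p q pq h X3.
apply: leq_trans h _; case: p pq => [|[|[|[|p]]]] pq; nia.
Qed.

(** Below 16 = 4 * 5 - 4 vertices some inner degree is at most 4, so each vertex beyond the ninth
    adds at most 8 to the degree sum. *)
Lemma degsum_le15 n (X : {set n.-tuple 'Z_4}) : 9 <= #|X| <= 15 ->
  degsum X + 44 <= 8 * #|X|.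
Proof.
move: {2}#|X| (leqnn #|X|) => m; elim: m X => [|m IH] X Xm /andP[X9 X15]; first lia.
case: (leqP #|X| 9) => X9'; first by have := @degsum_le9 _ X; lia.
have X0 : X != set0 by rewrite -card_gt0; lia.
have [x xX dx] : exists2 x, x \in X & #|inner_nbrs X x| < 5 by apply: exists_degree_lt => //; lia.
have cX : #|X| = #|X :\ x|.+1 by rewrite (cardsD1 x) xX.
have := IH (X :\ x); rewrite (degsum_rem xX); lia.
Qed.

(** * Slicing along the last coordinate *)

Definition snoc n (t : n.-tuple 'Z_4) (c : 'Z_4) : n.+1.-tuple 'Z_4 := [tuple of rcons t c].

Definition slice n (X : {set n.+1.-tuple 'Z_4}) (c : 'Z_4) : {set n.-tuple 'Z_4} :=
  [set t | snoc t c \in X].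

(** An edge that moves the last coordinate changes only a_0 once that coordinate is forgotten; this
    relation therefore describes the edges between neighboring copies. *)
Definition adj0 n (t u : n.+1.-tuple 'Z_4) :=
  (u == bh_nbr t 1%R ord0) || (u == bh_nbr t (-1)%R ord0).

Lemma snoc_nth n (t : n.-tuple 'Z_4) c j :
  ((snoc t c)`_j = if (j < n)%N then t`_j else if j == n then c else 0)%R.
Proof. by rewrite nth_rcons size_tuple. Qed.

Lemma bh_nbr_nat n (t : n.-tuple 'Z_4) s i j : j < n ->
  ((bh_nbr t s i)`_j = if j == 0%N then t`_0 + s
     else if j == i then t`_j + (if parity t then -1 else 1) else t`_j)%R.
Proof. by move=> jn; rewrite (bh_nbr_nth t s i (Ordinal jn)) sign_parity -val_eqE. Qed.

Lemma parity_snoc n (t : n.+1.-tuple 'Z_4) c : parity (snoc t c) = parity t.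
Proof. by rewrite /parity snoc_nth. Qed.

Lemma adj0_sym n : symmetric (@adj0 n).
Proof.
suff sub t u : @adj0 n t u -> adj0 u t by move=> t u; apply/idP/idP; apply: sub.
case/orP => /eqP->; apply/orP; [right|left]; apply/eqP.
  by rewrite (@bh_nbrK _ t 1%R ord0).
by rewrite -{1}(@bh_nbrK _ t (-1)%R ord0) ?opprK ?eqxx ?orbT.
Qed.

Lemma adj0_bh n (t u : n.+1.-tuple 'Z_4) : adj0 t u -> bh_adj t u.
Proof. by move=> tu; apply/existsP; exists ord0. Qed.

Lemma adj0_degree n (t : n.+1.-tuple 'Z_4) : \sum_u adj0 t u = 2.
Proof.
have -> : \sum_u adj0 t u = #|[set bh_nbr t 1%R ord0; bh_nbr t (-1)%R ord0]|.
  rewrite -sum1_card [RHS]big_mkcond /=; apply: eq_bigr => u _.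
  by rewrite !inE /adj0; case: (_ || _).
rewrite cards2; case: eqP => // /(congr1 (fun u : n.+1.-tuple _ => (u : seq _)`_0)%R).
by rewrite !bh_nbr_nth0 => /addrI /eqP.
Qed.

Lemma snoc_adj n (t u : n.+1.-tuple 'Z_4) c : bh_adj t u -> bh_adj (snoc t c) (snoc u c).
Proof.
case/bh_adjP => s [i [s1 ->]]; apply/bh_adjP; exists s, (widen_ord (leqnSn _) i).
split=> //; apply: eq_from_tnth => j; rewrite !(tnth_nth 0%R) bh_nbr_nat // !snoc_nth parity_snoc.
case: ltnP => jn; first by rewrite bh_nbr_nat.
have jE : j = n.+1 :> nat by apply/eqP; rewrite eqn_leq jn -ltnS ltn_ord.
rewrite jE eqxx /=; case: eqP => // E.
by have := ltn_ord i; rewrite -E ltnn.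
Qed.

Lemma snoc_adj0 n (t u : n.+1.-tuple 'Z_4) c :
  adj0 t u -> bh_adj (snoc t c) (snoc u (if parity t then c - 1 else c + 1)%R).
Proof.
move=> tu; have [s [s1 ->]] : exists s, (s == 1%R) || (s == -1)%R /\ u = bh_nbr t s ord0.
  by case/orP: tu => /eqP->; [exists 1%R|exists (-1)%R]; rewrite eqxx ?orbT.
apply/bh_adjP; exists s, ord_max; split=> //.
apply: eq_from_tnth => j; rewrite !(tnth_nth 0%R) bh_nbr_nat // !snoc_nth parity_snoc.
case: ltnP => jn.
  by rewrite bh_nbr_nat //= (ltn_eqF jn); case: eqP.
have jE : j = n.+1 :> nat by apply/eqP; rewrite eqn_leq jn -ltnS ltn_ord.
by rewrite jE eqxx; case: (parity t).
Qed.

Definition unsnoc n (x : n.+1.-tuple 'Z_4) : n.-tuple 'Z_4 :=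
  [tuple tnth x (widen_ord (leqnSn n) i) | i < n].

Lemma unsnocK n (x : n.+1.-tuple 'Z_4) : snoc (unsnoc x) (tnth x ord_max) = x.
Proof.
apply: eq_from_tnth => j; rewrite (tnth_nth 0%R) snoc_nth.
case: ltnP => jn.
  rewrite -(tnth_nth 0%R _ (Ordinal jn)) tnth_mktuple; congr tnth; exact: val_inj.
have jE : j = n :> nat by apply/eqP; rewrite eqn_leq jn -ltnS ltn_ord.
by rewrite jE eqxx; congr tnth; apply: val_inj.
Qed.

Lemma snocK n (t : n.-tuple 'Z_4) c : unsnoc (snoc t c) = t.
Proof.
apply: eq_from_tnth => j.
by rewrite tnth_mktuple !(tnth_nth 0%R) snoc_nth /= ltn_ord.
Qed.

Lemma sum_snoc n (F : n.+1.-tuple 'Z_4 -> nat) :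
  \sum_x F x = \sum_(c : 'Z_4) \sum_(t : n.-tuple 'Z_4) F (snoc t c).
Proof.
rewrite pair_big /= (reindex (fun p : 'Z_4 * n.-tuple 'Z_4 => snoc p.2 p.1)) //.
exists (fun x => (tnth x ord_max, unsnoc x)) => [[c t] _|x _] /=.
  by rewrite snocK (tnth_nth 0%R) snoc_nth /= ltnn eqxx.
by rewrite unsnocK.
Qed.

Lemma card_slices n (X : {set n.+1.-tuple 'Z_4}) : \sum_c #|slice X c| = #|X|.
Proof.
rewrite -[RHS]sum1_card [RHS]big_mkcond sum_snoc; apply: eq_bigr => c _.
rewrite -[LHS]sum1_card [LHS]big_mkcond; apply: eq_bigr => t _.
by rewrite inE.
Qed.

(** For X a parity part of one slice and Y the neighboring slice on its side, this counts the
    boundary edges that go from X into the neighboring copy. *)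
Definition cross n (X Y : {set n.+1.-tuple 'Z_4}) := \sum_(t in X) \sum_(u in ~: Y) adj0 t u.

(** Each vertex of [part b X] sends two [adj0] edges. Those that do not leave Y end in the opposite
    part of Y, where each vertex receives at most two of them. *)
Lemma cross_ge n (X Y : {set n.+1.-tuple 'Z_4}) b :
  2 * #|part b X| <= cross (part b X) Y + 2 * #|part (~~ b) Y|.
Proof.
rewrite mulnC -sum_nat_const [X in _ <= _ + X]mulnC -sum_nat_const.
have -> : \sum_(u in part (~~ b) Y) 2 = \sum_(u in part (~~ b) Y) \sum_t adj0 t u.
  apply: eq_bigr => u _; rewrite -[LHS](adj0_degree u).
  by apply: eq_bigr => t _; rewrite adj0_sym.
rewrite exchange_big /cross (eq_bigr (fun t => \sum_u adj0 t u)); last first.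
  by move=> t _; rewrite adj0_degree.
apply: leq_trans (_ : \sum_(t in part b X) (\sum_(u in ~: Y) adj0 t u +
    \sum_(u in part (~~ b) Y) adj0 t u) <= _); last first.
  rewrite big_split leq_add2l [X in X <= _]big_mkcond; apply: leq_sum => t _.
  by case: ifP.
apply: leq_sum => t; rewrite inE => /andP[_ /eqP pt].
rewrite (bigID (mem Y)) [X in _ <= X]addnC /=; apply: leq_add; last first.
  by apply: eq_leq; apply: eq_bigl => u; rewrite inE.
rewrite big_mkcond [X in _ <= X]big_mkcond; apply: leq_sum => u _.
rewrite inE; case: ifP => //= _; case: (boolP (adj0 t u)) => // /adj0_bh/bh_adj_parity ->.
by rewrite pt eqxx.
Qed.

(** Even vertices send their edges between copies to copy c + 1, odd ones to copy c - 1, by the sign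
    in the last coordinate. *)
Lemma boundary_slices n (X : {set n.+2.-tuple 'Z_4}) :
  \sum_c (boundary (slice X c) + cross (part false (slice X c)) (slice X (c + 1)%R)
    + cross (part true (slice X c)) (slice X (c - 1)%R)) <= boundary X.
Proof.
rewrite /boundary [X in _ <= X]big_mkcond sum_snoc; apply: leq_sum => c _.
rewrite -addnA.
have -> : cross (part false (slice X c)) (slice X (c + 1)%R)
    + cross (part true (slice X c)) (slice X (c - 1)%R) =
    \sum_(t in slice X c) \sum_(u in ~: slice X (if parity t then c - 1 else c + 1)%R) adj0 t u.
  rewrite [RHS](bigID (@parity _)) addnC; congr (_ + _).
    apply: eq_big => [t|t]; first by rewrite [in LHS]inE eqb_id.
    by rewrite inE => /andP[_ /eqP->].
  apply: eq_big => [t|t]; first by rewrite [in LHS]inE eqbF_neg.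
  by rewrite inE => /andP[_ /eqP->].
rewrite -big_split big_mkcond /=; apply: leq_sum => t _.
rewrite inE; case: ifP => // tX.
rewrite card_nbrs card_nbrs [X in _ <= X]big_mkcond sum_snoc.
set d := (if _ then _ else _).
(* Hence edges inside copy c and edges to copy d are counted in different terms of the sum over the
   last coordinate. *)
have cd : d != c.
  by rewrite /d; case: (parity t); clear; case: c => [[|[|[|[|]]]]].
rewrite (bigD1 c) //= (bigD1 d) //= addnA; apply: leq_trans (leq_addr _ _).
apply: leq_add; rewrite big_mkcond; apply: leq_sum => u _; rewrite !inE; case: ifP => // uX.
  by case: (boolP (bh_adj t u)) => // /snoc_adj ->.
by case: (boolP (adj0 t u)) => // /snoc_adj0 ->.
Qed.

(** The indices are written as repeated sums so that c + 1 and c - 1 match them by rewriting. *)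
Lemma sum_Z4 (F : 'Z_4 -> nat) :
  \sum_c F c = F 0%R + F 1%R + F (1 + 1)%R + F (1 + 1 + 1)%R.
Proof.
rewrite !big_ord_recl big_ord0 addn0 !addnA.
by congr (F _ + F _ + F _ + F _); apply: val_inj.
Qed.

(** * The lower bound on boundaries, by induction on the dimension *)

Lemma card_bh n : #|{: n.-tuple 'Z_4}| = 4 ^ n.
Proof. by rewrite card_tuple card_ord. Qed.

(** No edge leaves the full vertex set, so [cross_ge], applied both ways, shows that its two parity
    classes have equal size. *)
Lemma card_part_le n (X : {set n.+1.-tuple 'Z_4}) b : 2 * #|part b X| <= 4 ^ n.+1.
Proof.
have cr0 c : cross (part c [set: n.+1.-tuple 'Z_4]) setT = 0.
  by rewrite /cross big1 // => t _; rewrite big1 // => u; rewrite !inE.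
have h1 := cross_ge [set: n.+1.-tuple 'Z_4] setT true.
have h2 := cross_ge [set: n.+1.-tuple 'Z_4] setT false.
have h3 := card_part [set: n.+1.-tuple 'Z_4].
rewrite cr0 [~~ _]/= in h1; rewrite cr0 [~~ _]/= in h2; rewrite cardsT card_bh in h3.
have : #|part b X| <= #|part b [set: n.+1.-tuple 'Z_4]|.
  by apply: subset_leq_card; apply/subsetP => x; rewrite !inE => /andP[_ ->].
case: b; lia.
Qed.

(* Here slice i has e_i even and o_i odd vertices and boundary b_i inside its copy,
   and k_i, l_i count the boundary edges from its even vertices to slice i+1 and
   from its odd vertices to slice i-1.  In a copy with 2h vertices, a jump from
   nearly full to nearly empty costs 2h once the edges inside are included. *)
Lemma four_slices (h t A A' B : nat) (b0 b1 b2 b3 e0 e1 e2 e3 o0 o1 o2 o3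
    k0 k1 k2 k3 l0 l1 l2 l3 : nat) :
  let cls b e o :=
    [\/ t <= e + o /\ A' <= b, e + o < t /\ 2 * (e + o) <= b |
        2 * h < e + o + t /\ 4 * h <= b + 2 * (e + o)] in
  cls b0 e0 o0 -> cls b1 e1 o1 -> cls b2 e2 o2 -> cls b3 e3 o3 ->
  e0 <= h -> e1 <= h -> e2 <= h -> e3 <= h ->
  o0 <= h -> o1 <= h -> o2 <= h -> o3 <= h ->
  2 * e0 <= k0 + 2 * o1 -> 2 * e1 <= k1 + 2 * o2 -> 2 * e2 <= k2 + 2 * o3 ->
  2 * e3 <= k3 + 2 * o0 ->
  2 * o0 <= l0 + 2 * e3 -> 2 * o1 <= l1 + 2 * e0 -> 2 * o2 <= l2 + 2 * e1 ->
  2 * o3 <= l3 + 2 * e2 ->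
  b0 + k0 + l0 + (b1 + k1 + l1) + (b2 + k2 + l2) + (b3 + k3 + l3) <= B ->
  e0 + o0 + (e1 + o1) + (e2 + o2) + (e3 + o3) <= 4 * h ->
  3 * t < 2 * h + 3 -> A <= 2 * A' -> A <= 2 * h ->
  let mid b e o := [/\ t <= e + o, A' <= b & b + 2 * (e + o) <= B] in
  A <= B \/ [/\ e0 + o0 < t, e1 + o1 < t, e2 + o2 < t & e3 + o3 < t] \/
  [\/ mid b0 e0 o0, mid b1 e1 o1, mid b2 e2 o2 | mid b3 e3 o3].
Proof.
move=> cls c0 c1 c2 c3 *; rewrite {}/cls in c0 c1 c2 c3 *.
case: (leqP A B) => AB; [by left|right].
(* With B < A, two intermediate slices are impossible, and so is a nearly full slice beside a nearly
   empty one. The bound on t excludes one intermediate and three nearly full slices, as the total is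
   at most half of the vertices. *)
case: c0 => [[? ?]|[? ?]|[? ?]]; case: c1 => [[? ?]|[? ?]|[? ?]];
case: c2 => [[? ?]|[? ?]|[? ?]]; case: c3 => [[? ?]|[? ?]|[? ?]];
try (exfalso; lia);
first [left; split; lia | right; constructor 1; split; lia
  | right; constructor 2; split; lia | right; constructor 3; split; lia
  | right; constructor 4; split; lia].
Qed.

(** For n >= 2, the largest g + 1 that g <= 8 and n >= 6 - 12/(g+1) allow. *)
Definition threshold n := if n <= 2 then 3 else if n == 3 then 4 else if n == 4 then 6 else 9.

(* [2 n m - 4 (m - 2)], the boundary size of a complete bipartite K_(2,m-2). *)
Definition cut_bound n m := 2 * m * (n - 2) + 8.

Lemma threshold_cases n : 2 <= n ->
  [\/ n = 2 /\ threshold n = 3, n = 3 /\ threshold n = 4, n = 4 /\ threshold n = 6 |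
      5 <= n /\ threshold n = 9].
Proof.
case: n => [|[|[|[|[|n]]]]] // _;
  [constructor 1|constructor 2|constructor 3|constructor 4]; by split.
Qed.

Lemma expn4_lower n : 5 <= n -> 18 * n <= 4 ^ (n - 1).
Proof.
case: n => [|[|[|[|[|n]]]]] // _; rewrite subn1 /=.
elim: n => [//|n IH]; rewrite expnS; lia.
Qed.

(** The dimension p is free so that slices, which live in dimension n - 1, are covered too. For n =
    3 and 15 vertices, [degsum_le15] would leave only 90 - 76 = 14, short of the bound 16. *)
Lemma degsum_small n p (X : {set p.-tuple 'Z_4}) : 2 < n -> threshold n <= #|X| <= 15 ->
  (n = 3 -> #|X| <= 14) -> cut_bound n (threshold n) + degsum X <= 2 * n * #|X|.
Proof.
move=> n2 /andP[tX X15] X14; rewrite /cut_bound.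
have h1 := @degsum_le9 _ X; have h2 := @degsum_le15 _ X.
case: (threshold_cases (ltnW n2)) => -[nE tE]; rewrite tE in tX *; try subst n.
- by [].
- have {}X14 := X14 erefl.
  case: (leqP #|X| 9) => X9; first by have := h1 ltac:(lia); lia.
  by have := h2 ltac:(lia); lia.
- case: (leqP #|X| 9) => X9; first by have := h1 ltac:(lia); lia.
  by have := h2 ltac:(lia); lia.
- have := h2 ltac:(lia); move: tX nE; clear; move: (degsum X) #|X| => d m; nia.
Qed.

Lemma boundary_ge2 n (X : {set n.-tuple 'Z_4}) : 1 < n -> #|X| < threshold n.+1 ->
  2 * #|X| <= boundary X.
Proof.
move=> n2; have := boundary_degsum X.
have h1 := @degsum_le4 _ X; have h2 := @degsum_le2 _ X.
case: (threshold_cases (leqW n2)) => -[nE ->] bX X3.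
- lia.
- have := h2 X3; move: bX; have -> : 2 * n * #|X| = 4 * #|X| by congr (_ * _); lia.
  lia.
- have := h1 ltac:(lia); move: bX; have : 3 <= n by lia.
  clear; move: (boundary X) (degsum X) #|X| => b d m; nia.
- have := h1 ltac:(lia); move: bX; have : 3 <= n by lia.
  clear; move: (boundary X) (degsum X) #|X| => b d m; nia.
Qed.

Lemma boundary_ge_small n (X : {set n.+1.-tuple 'Z_4}) : #|X| <= 9 ->
  (2 * n - 2) * #|X| <= boundary X.
Proof.
move=> /degsum_le4; have := boundary_degsum X.
move: (boundary X) (degsum X) #|X| => b d m; nia.
Qed.

(** This settles two intermediate slices; [cut_bound_step] settles a single one of m vertices, and
    [cut_bound_half] a jump from nearly full to nearly empty. *)
Lemma cut_bound_double n : 2 < n ->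
  cut_bound n (threshold n) <= 2 * cut_bound n.-1 (threshold n.-1).
Proof.
move=> n2; rewrite /cut_bound; case: (threshold_cases (ltnW n2)) => -[nE tE]; rewrite tE;
  try by subst n.
have : 4 <= n.-1 by lia.
have [|n5] := eqVneq n 5; first by move=> ->.
have : threshold n.-1 = 9 by case: (@threshold_cases n.-1 ltac:(lia)) => -[]; lia.
by move=> ->; lia.
Qed.

Lemma cut_bound_step n m : 2 < n -> threshold n <= m -> (n == 3) || (15 < m) ->
  cut_bound n (threshold n) <= cut_bound n.-1 (threshold n.-1) + 2 * m.
Proof.
move=> n2; rewrite /cut_bound; case: (threshold_cases (ltnW n2)) => -[nE tE]; 
  rewrite tE => mt m15; try subst n.
- by [].
- by rewrite -[threshold 3.-1]/3; lia.
- by rewrite -[threshold 4.-1]/4; lia.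
have [n5|n5] := eqVneq n 5; first by subst n; rewrite -[threshold 5.-1]/6; lia.
have -> : threshold n.-1 = 9 by case: (@threshold_cases n.-1 ltac:(lia)) => -[]; lia.
lia.
Qed.

Lemma cut_bound_half n : 2 < n -> cut_bound n (threshold n) <= 4 ^ n.-1.
Proof.
move=> n2; rewrite /cut_bound; case: (threshold_cases (ltnW n2)) => -[nE tE]; rewrite tE;
  try by subst n.
by have := expn4_lower nE; rewrite subn1; lia.
Qed.

Lemma threshold_mono n : 2 < n -> threshold n.-1 <= threshold n.
Proof. by case: n => [|[|[|[|[|[|n]]]]]]. Qed.

Lemma threshold_half n : 2 < n -> 3 * threshold n < 4 ^ n.-1 + 3.
Proof.
move=> n2; case: (threshold_cases (ltnW n2)) => -[nE ->]; try by subst n.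
by have := expn4_lower nE; rewrite subn1; lia.
Qed.

Lemma boundary_ge_threshold n (X : {set n.-tuple 'Z_4}) : 2 <= n ->
  threshold n <= #|X| -> #|X| + threshold n <= 4 ^ n ->
  cut_bound n (threshold n) <= boundary X.
Proof.
move=> n2; elim: n n2 X => [//|n IH] n2 X.
wlog Xhalf : X / 2 * #|X| <= 4 ^ n.+1.
  move=> W tX Xt; have cX := cardsC X; rewrite card_bh in cX.
  case: (leqP (2 * #|X|) (4 ^ n.+1)) => Xh; first exact: W.
  by rewrite -boundaryC; apply: W; lia.
case: n IH n2 X Xhalf => [//|[|n]] IH n2 X Xhalf tX Xt.
  (* In dimension 2, X has at most 8 vertices, and 4|X| - (4|X| - 8) = 8 is the bound. *)
  have := boundary_degsum X; have := @degsum_le9 _ X.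
  rewrite /cut_bound; rewrite -[threshold 2]/3 in tX Xt *; have : 4 ^ 2 = 16 by []. lia.
have {}IH := IH isT.
set N := n.+2 in IH n2 X Xhalf tX Xt *.
have N2 : 2 < N.+1 by [].
have [h hN] : exists h, 4 ^ N = 2 * h by exists (2 * 4 ^ n.+1); rewrite /N expnS mulnA.
have cls (c : 'Z_4) : let S := slice X c in let e := #|part false S| in
    let o := #|part true S| in
    [\/ threshold N.+1 <= e + o /\ cut_bound N (threshold N) <= boundary S,
        e + o < threshold N.+1 /\ 2 * (e + o) <= boundary S |
        2 * h < e + o + threshold N.+1 /\ 4 * h <= boundary S + 2 * (e + o)].
  move=> S e o; have eoS : e + o = #|S| by rewrite addnC card_part.
  rewrite eoS; case: (leqP (threshold N.+1) #|S|) => St; last first.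
    by constructor 2; split=> //; apply: boundary_ge2.
  have cS := cardsC S; rewrite card_bh in cS.
  case: (leqP (#|S| + threshold N.+1) (4 ^ N)) => St'.
    have tm := @threshold_mono N.+1 N2.
    constructor 1; split=> //; apply: IH; rewrite /= in tm; lia.
  (* The complement of a nearly full slice is small and has the same boundary. *)
  have := @boundary_ge2 _ (~: S) isT; rewrite boundaryC => low.
  by constructor 3; split; lia.
have cS : \sum_c #|slice X c| = #|X| := card_slices X.
have bS := boundary_slices X; rewrite !sum_Z4 in cS bS.
have E3 : (1 + 1 + 1 + 1 = 0 :> 'Z_4)%R by apply: val_inj.
have E0 : (0 - 1 = 1 + 1 + 1 :> 'Z_4)%R by apply: val_inj.
rewrite E3 E0 add0r subrr !addrK in bS.
have eoS c : #|slice X c| = #|part false (slice X c)| + #|part true (slice X c)|.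
  by rewrite addnC card_part.
rewrite !eoS in cS.
have p2 b c := card_part_le (slice X c) b.
have k c d := cross_ge (slice X c) (slice X d) false.
have l c d := cross_ge (slice X c) (slice X d) true.
have half b c : #|part b (slice X c)| <= h by have := p2 b c; rewrite hN leq_pmul2l.
have Xh : #|X| <= 4 * h by move: Xhalf; rewrite expnS hN; lia.
have {cls}FS := @four_slices h (threshold N.+1)
  (cut_bound N.+1 (threshold N.+1)) (cut_bound N (threshold N)) (boundary X)
  _ _ _ _ _ _ _ _ _ _ _ _ _ _ _ _ _ _ _ _ (cls 0%R) (cls 1%R) (cls (1 + 1)%R) (cls (1 + 1 + 1)%R)
  (half _ _) (half _ _) (half _ _) (half _ _) (half _ _) (half _ _) (half _ _) (half _ _)
  (k _ _) (k _ _) (k _ _) (k _ _) (l _ _) (l _ _) (l _ _) (l _ _) bS.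
have mid c : [/\ threshold N.+1 <= #|slice X c|, cut_bound N (threshold N) <= boundary (slice X c) &
    boundary (slice X c) + 2 * #|slice X c| <= boundary X] ->
  cut_bound N.+1 (threshold N.+1) <= boundary X.
  case=> tS AS SX; have [xS|xS] := boolP ((N.+1 == 3) || (15 < #|slice X c|)).
    by apply: leq_trans (cut_bound_step N2 tS xS) (leq_trans _ SX); rewrite leq_add2r.
  (* For a slice S of at most 15 vertices, bd S + 2|S| equals 2(N+1)|S| minus its degree sum, the
     quantity that [degsum_small] bounds. *)
  have := @degsum_small N.+1 _ (slice X c) N2; have := boundary_degsum (slice X c).
  move: (boundary _) (boundary _) (degsum _) #|slice X c| SX xS tS => b1 b2 d m; nia.
case: FS.
- by rewrite cS.
- by have := @threshold_half N.+1 N2; rewrite -hN.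
- by have := @cut_bound_double N.+1 N2.
- by have := @cut_bound_half N.+1 N2; rewrite -hN.
- by [].
case; last by rewrite -!eoS; case; apply: mid.
rewrite -!eoS in cS *; case=> s0 s1 s2 s3.
have t9 : threshold N.+1 <= 9 by case: (threshold_cases n2) => -[_ ->].
case: (leqP #|X| 15) => X15.
  have := boundary_degsum X; have := @degsum_small N.+1 _ X N2.
  have : N.+1 = 3 -> #|X| <= 14.
    move=> N3; move: s0 s1 s2 s3.
    have -> : threshold N.+1 = 4 by apply: (congr1 threshold N3).
    lia.
  lia.
(* Here |X| >= 16, and bd X >= 2n|X| is enough: in dimensions n + 3 = 4 and 5 it gives 32 and 64
   against the bounds 32 and 62. In dimension 3, four slices of at most 3 vertices cannot reach
   16. *)
have low c : #|slice X c| < threshold N.+1 -> 2 * n * #|slice X c| <= boundary (slice X c).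
  move=> sc; apply: leq_trans (boundary_ge_small (leq_trans (ltnW sc) t9)).
  by rewrite leq_mul2r mulnS addnC addnK leqnn orbT.
have : 2 * n * #|X| <= boundary X.
  rewrite -cS !mulnDr; apply: leq_trans bS.
  by do 3?apply: leq_add; rewrite -addnA; apply: leq_trans (low _ _) (leq_addr _ _).
rewrite /cut_bound; case: (threshold_cases n2) => -[nE tE]; rewrite tE in s0 s1 s2 s3 *.
- by [].
- by move: X15; rewrite -cS; lia.
- move: X15 nE; rewrite /N; move: (boundary X) #|X|; clear; nia.
- move: X15 nE; rewrite /N; move: (boundary X) #|X|; clear; nia.
Qed.

(** If X and its complement both reach the threshold, [boundary_ge_threshold] applies. Otherwise the
    smaller one has p <= 8 vertices and [degsum_le9] gives 2p(n-2) + 8, which increases with p. *)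
Lemma boundary_ge n m (X : {set n.-tuple 'Z_4}) : 2 <= n -> 3 <= m <= threshold n ->
  m <= #|X| -> #|X| + m <= 4 ^ n -> cut_bound n m <= boundary X.
Proof.
move=> n2 /andP[m3 mt].
have t9 : threshold n <= 9 by case: (threshold_cases n2) => -[_ ->].
wlog Xt : X / #|X| < threshold n.
  move=> W mX Xm; have cX := cardsC X; rewrite card_bh in cX.
  case: (ltnP #|X| (threshold n)) => Xt; first exact: W.
  case: (ltnP #|~: X| (threshold n)) => Xt'.
    by rewrite -boundaryC; apply: W => //; lia.
  apply: leq_trans (boundary_ge_threshold n2 Xt _); last by lia.
  by rewrite /cut_bound leq_add2r leq_mul // leq_mul.
move=> mX _; have := @degsum_le9 _ X; have := boundary_degsum X.
rewrite /cut_bound; move: (boundary X) (degsum X) #|X| mX Xt => b d p; nia.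
Qed.

(** * Edge-cuts as boundaries of vertex sets *)

Definition boundary_pairs n (U : {set BH n}) : {set BH n * BH n} :=
  [set p | [&& p.1 \in U, p.2 \notin U & adj p.1 p.2]].

Definition boundary_cut n (U : {set BH n}) : {set {set BH n}} :=
  [set [set p.1; p.2] | p in boundary_pairs U].

Lemma card_boundary_pairs n (U : {set BH n}) : #|boundary_pairs U| = boundary U.
Proof.
rewrite -sum1_card /boundary.
under [RHS]eq_bigr do rewrite -sum1_card.
rewrite pair_big_dep; apply: eq_bigl => -[x y].
by rewrite !inE.
Qed.

(** An edge of the cut has exactly one end in U, so it determines its ordered pair. *)
Lemma card_boundary_cut n (U : {set BH n}) : #|boundary_cut U| = boundary U.
Proof.
rewrite -card_boundary_pairs card_in_imset // => -[x y] [x' y']; rewrite !inE /=.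
move=> /and3P[xU yU _] /and3P[xU' yU' _] E.
have := set21 x y; have := set22 x y; rewrite E !inE.
have -> : (y == x') = false by apply: contraNF yU => /eqP->.
have -> : (x == y') = false by apply: contraTF xU => /eqP->.
by rewrite orbF /= => /eqP-> /eqP->.
Qed.

Lemma mem_boundary_cut n (U : {set BH n}) (x y : BH n) :
  adj x y -> ([set x; y] \in boundary_cut U) = ((x \in U) != (y \in U)).
Proof.
move=> xy; apply/imsetP/idP => [[[u v]]|].
  rewrite inE /= => /and3P[uU vU uv] E.
  have : x \in [set u; v] by rewrite -E set21.
  have : y \in [set u; v] by rewrite -E set22.
  have nxy : x != y by apply: contraTneq xy => ->; rewrite adj_irr.
  rewrite !inE => /orP[]/eqP yE /orP[]/eqP xE; subst; rewrite ?eqxx // in nxy *;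
  by rewrite uU (negbTE vU).
case: (boolP (x \in U)) => xU yU.
  by exists (x, y) => //; rewrite inE xU xy; case: (_ \in U) yU.
by exists (y, x); rewrite /= 1?setUC // inE xU adj_sym xy; case: (_ \in U) yU.
Qed.

Lemma del_boundary_cut n (U : {set BH n}) (x y : BH n) :
  del_adj (boundary_cut U) x y = adj x y && ((x \in U) == (y \in U)).
Proof.
rewrite /del_adj; case: (boolP (adj x y)) => //= xy.
by rewrite mem_boundary_cut // negbK.
Qed.

Lemma boundary_cut_edges n (U : {set BH n}) : boundary_cut U \subset edges (BH n).
Proof.
apply/subsetP => f /imsetP[p]; rewrite inE => /and3P[_ _ p_adj] ->.
by apply/imsetP; exists p; rewrite ?inE.
Qed.

(** U stays connected. Outside U, two adjacent vertices each keep at least n neighbors, and these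
    neighborhoods are disjoint by parity, so each outside component has at least 2n > g vertices. *)
Lemma extra_edge_cut_boundary_cut n g (U : {set BH n}) (r : BH n) :
    0 < n -> #|U| = g.+1 -> g < 2 * n -> r \in U ->
    (forall u, u \in U -> connect (fun x y => [&& x \in U, y \in U & adj x y]) r u) ->
    (forall z, z \notin U -> #|inner_nbrs U z| <= n) ->
  extra_edge_cut g (boundary_cut U).
Proof.
move=> n_gt0 cU gn rU Uc outU.
have Ucon u : u \in U -> connect (del_adj (boundary_cut U)) r u.
  move=> /Uc; apply: connect_sub => x y /and3P[xU yU xy].
  by apply: connect1; rewrite del_boundary_cut xy xU yU.
have csym := sym_connect_sym (del_adj_sym (boundary_cut U)).
rewrite /extra_edge_cut /edge_cut boundary_cut_edges /=; apply/andP; split.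
  have [z zU] : exists z, z \notin U.
    apply/existsP; apply: contraT; rewrite negb_exists => /forallP h.
    have : #|U| = 4 ^ n.
      rewrite -card_bh; apply: eq_card => x; have := h x; rewrite negbK => ->.
      by rewrite inE.
    have : 2 * n < 4 ^ n by move: (n); elim=> // m; rewrite expnS; lia.
    lia.
  apply/negP => /forallP/(_ r)/forallP/(_ z) rz.
  have cl : closed (del_adj (boundary_cut U)) (mem U).
    by move=> x y; rewrite del_boundary_cut => /andP[_ /eqP].
  by have := closed_connect cl rz; rewrite /= rU (negbTE zU).
apply/forall_inP => C /imsetP[x _ ->] {C}.
case: (boolP (x \in U)) => xU.
  rewrite -cU; apply: subset_leq_card; apply/subsetP => u uU; rewrite inE.
  by apply: (connect_trans (y := r)); [rewrite csym|]; apply: Ucon.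
have nb (z : BH n) : z \notin U -> n <= #|inner_nbrs (~: U) z|.
  move=> /outU out; rewrite -(leq_add2l #|inner_nbrs U z|) card_nbrsC mul2n -addnn.
  by rewrite leq_add2r.
have [y] : exists y, y \in inner_nbrs (~: U) x by apply/card_gt0P; have := nb x xU; lia.
have nbc (z w : BH n) : z \notin U -> w \in inner_nbrs (~: U) z ->
      connect (del_adj (boundary_cut U)) z w.
  rewrite !inE => zU /andP[wU zw]; apply: connect1.
  by rewrite del_boundary_cut [adj z w]zw (negbTE zU) (negbTE wU).
move=> yx; have yx' := yx; move: yx; rewrite !inE => /andP[yU xy].
apply: leq_trans gn _; rewrite mul2n -addnn.
apply: leq_trans (leq_add (nb x xU) (nb y yU)) _.
rewrite -cardsUI (_ : _ :&: _ = set0) ?cards0 ?addn0.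
  apply: subset_leq_card; apply/subsetP => u; rewrite in_setU => uxy; rewrite inE.
  case/orP: uxy => uN; first exact: nbc.
  exact: connect_trans (nbc _ _ xU yx') (nbc _ _ yU uN).
apply/setP => u; rewrite !inE; apply/negP => /andP[/andP[_ xu] /andP[_ yu]].
have := bh_adj_parity xu; rewrite (bh_adj_parity yu) (bh_adj_parity xy).
by case: (parity x).
Qed.

(** C is a component after deletion: every edge leaving it lies in F, and its complement contains
    another component. *)
Lemma extra_edge_cut_boundary n g (F : {set {set BH n}}) : extra_edge_cut g F ->
  exists C : {set BH n}, [/\ g < #|C|, #|C| + g < 4 ^ n & boundary C <= #|F|].
Proof.
case/andP => /andP[_ nconn] /forall_inP comp.
have csym := sym_connect_sym (del_adj_sym F).
have big x : g < #|component (x : del_edges F)|.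
  by apply: comp; apply: imset_f.
move: nconn; rewrite negb_forall => /existsP[x]; rewrite negb_forall => /existsP[y nxy].
pose C : {set BH n} := component (x : del_edges F).
exists C; split; first exact: big.
  have cC := cardsC C; rewrite card_bh in cC.
  have : #|component (y : del_edges F)| <= #|~: C|.
    apply: subset_leq_card; apply/subsetP => z; rewrite !inE => yz.
    by apply: contra nxy => xz; apply: connect_trans xz _; rewrite csym.
  by have := big y; rewrite -cC => h1 h2; rewrite ltn_add2l; apply: leq_trans h2.
rewrite -card_boundary_cut; apply: subset_leq_card; apply/subsetP => f /imsetP[[u v]].
rewrite !inE /= => /and3P[xu xv uv] ->; apply: contraR xv => uvF.
by apply: connect_trans xu (connect1 _); rewrite /= /del_adj [adj u v]uv.
Qed.

Lemma extra_edge_connectivity_some n g m (F : {set {set BH n}}) :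
    extra_edge_cut g F -> #|F| <= m ->
  exists2 k, extra_edge_connectivity (BH n) g = Some k &
    k <= m /\ exists2 F' : {set {set BH n}}, extra_edge_cut g F' & #|F'| = k.
Proof.
move=> gF Fm; rewrite /extra_edge_connectivity.
case: pickP => [F0 gF0|]; last by move/(_ F); rewrite gF.
case: arg_minnP => // F1 gF1 F1min; exists #|F1| => //; split; last by exists F1.
exact: leq_trans (F1min F gF) Fm.
Qed.

(** * Cuts grown from a core that contains a twin pair *)

Lemma exists_subset_card (T : finType) (A : {set T}) k : k <= #|A| ->
  exists2 B : {set T}, B \subset A & #|B| = k.
Proof.
move=> kA; exists [set x in take k (enum A)].
  by apply/subsetP => x; rewrite inE => /mem_take; rewrite mem_enum.
rewrite cardsE; have /card_uniqP -> : uniq (take k (enum A)) by rewrite take_uniq ?enum_uniq.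
by rewrite size_takel // -cardE.
Qed.

(** Each vertex of S is adjacent to both v and [twin v], hence brings at least two edges. *)
Lemma degsum_setU_nbrs n (K S : {set n.-tuple 'Z_4}) v : 0 < n ->
    v \in K -> twin v \in K -> [disjoint S & K] -> {in S, forall x, bh_adj v x} ->
  degsum K + 4 * #|S| <= degsum (K :|: S).
Proof.
move=> n0 vK tK; move: {2}#|S| (erefl #|S|) => k; elim: k S => [|k IH] S Sk dis adjS.
  by rewrite Sk muln0 addn0 (cards0_eq Sk) setU0.
have [x xS] : exists x, x \in S by apply/card_gt0P; rewrite Sk.
have xK : x \notin K by rewrite (disjointFr dis).
have cS : #|S :\ x| = k by move: Sk; rewrite (cardsD1 x) xS => -[].
have {}IH := IH (S :\ x) cS (disjointWl (subD1set _ _) dis)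
  (fun y yS => adjS y (subsetP (subD1set S x) y yS)).
have xU : x \in K :|: S by rewrite in_setU xS orbT.
rewrite (degsum_rem xU) setDUl (setDidPl _); last by rewrite disjoint_sym disjoints1.
have : [set v; twin v] \subset inner_nbrs (K :|: S) x.
  apply/subsetP => y; rewrite !inE => /orP[]/eqP->; rewrite ?vK ?tK /= bh_adj_sym ?bh_adj_twin;
  exact: adjS.
move/subset_leq_card; rewrite cards2 eq_sym twin_neq // => d2.
rewrite Sk; move: IH d2; rewrite cS.
move: (degsum _) (degsum _) #|inner_nbrs _ _|; lia.
Qed.

(** K is filled up to g + 1 vertices by common neighbors of the twins. The last two hypotheses bound
    by n the neighbors of an outside vertex z: if z has the other parity than v, they lie in the
    part of v in K; otherwise z shares at most 2 with v, and the rest lie in K and are not adjacent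
    to v. *)
Lemma core_cut n g (K : {set BH n}) (v : BH n) :
    0 < n -> g < 2 * n -> #|K| <= g.+1 -> v \in K -> (twin v : BH n) \in K ->
    (forall u, u \in K -> connect (fun x y => [&& x \in K, y \in K & adj x y]) v u) ->
    #|part (parity v) K| <= n ->
    2 + #|[set k in part (~~ parity v) K | ~~ bh_adj v k]| <= n ->
  exists2 F : {set {set BH n}}, extra_edge_cut g F &
    #|F| + degsum K + 4 * (g.+1 - #|K|) <= 2 * n * g.+1.
Proof.
move=> n0 gn Kg vK tK conK par0 par1.
have [S] : exists2 S : {set BH n}, S \subset [set x | bh_adj v x] :\: K & #|S| = g.+1 - #|K|.
  apply: exists_subset_card; rewrite cardsD bh_degree; apply: leq_sub => //.
  by apply: subset_leq_card; apply: subsetIr.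
rewrite subsetD => /andP[adjS dis] cS.
have {}adjS : {in S, forall x, bh_adj v x} by move=> x /(subsetP adjS); rewrite inE.
pose U : {set BH n} := K :|: S.
have KU x : x \in K -> x \in U by rewrite inE => ->.
have cU : #|U| = g.+1.
  by rewrite cardsU disjoint_setI0 1?disjoint_sym // cards0 subn0 cS subnKC.
exists (boundary_cut U).
  apply: (extra_edge_cut_boundary_cut (r := v)) => //; first exact: KU.
    move=> u; rewrite inE => /orP[/conK|uS].
      apply: connect_sub => x y /and3P[xK yK xy]; apply: connect1.
      by rewrite !KU.
    apply: connect1; rewrite KU // inE uS orbT; exact: adjS.
  move=> z; rewrite inE negb_or => /andP[zK zS].
  have [pz|pz] := eqVneq (parity z) (parity v).
    have vz : v != z by apply: contraNneq zK => <-.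
    have vtz : v != twin z by apply: contraNneq zK => E; rewrite -(twinK z) -E.
    apply: leq_trans par1; apply: leq_trans (leq_add (card_nbrsI U vz vtz) (leqnn _)).
    apply: leq_trans (leq_card_setU _ _); apply: subset_leq_card.
    apply/subsetP => y yz; have := subsetP (nbrs_parts U z) y yz.
    move: yz; rewrite !inE pz => /andP[/orP[yK|yS] zy] /andP[_ py].
      by rewrite yK zy py; case: (bh_adj v y).
    by rewrite yS zy (adjS y yS) orbT.
  apply: leq_trans par0; apply: subset_leq_card; apply/subsetP => y yz.
  have := subsetP (nbrs_parts U z) y yz; rewrite !inE => /andP[/orP[yK|yS] py].
    by rewrite yK (eqP py); case: (parity z) pz; case: (parity v).
  by move: py; rewrite (bh_adj_parity (adjS y yS)) => /eqP; case: (parity z) pz; case: (parity v).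
have := degsum_setU_nbrs n0 vK tK dis adjS; rewrite cS => dU.
rewrite -addnA; rewrite card_boundary_cut; apply: leq_trans (leq_add (leqnn _) dU) _.
by rewrite boundary_degsum cU.
Qed.

(** The core is the path v, s, [twin v]; the common neighbor s makes it connected, and filling it up
    gives K_(2,g-1). *)
Lemma star_cut n g : 2 <= n -> 2 <= g < 2 * n ->
  exists2 F : {set {set BH n}}, extra_edge_cut g F & #|F| + 4 * (g - 1) <= 2 * n * g.+1.
Proof.
case: n => [//|n] n2 /andP[g2 gn].
pose v : BH n.+1 := [tuple of nseq n.+1 0%R]; pose s : BH n.+1 := bh_nbr v 1%R ord0.
pose K0 : {set BH n.+1} := [set v; (twin v : BH n.+1)]; pose K := K0 :|: [set s].
have vs : bh_adj v s by apply/bh_adjP; exists 1%R, ord0; rewrite eqxx.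
have tvs : bh_adj (twin v) s by rewrite bh_adj_twin.
have ps : parity s = ~~ parity v := bh_adj_parity vs.
have vK0 : v \in K0 by rewrite !inE eqxx.
have tK0 : (twin v : BH n.+1) \in K0 by rewrite !inE eqxx orbT.
have sK0 : s \notin K0.
  rewrite !inE; apply/norP; split; apply: contraTneq isT => E; move: ps; rewrite E ?parity_twin;
  by case: (parity v).
have dis : [disjoint [set s] & K0] by rewrite disjoints1.
have cK : #|K| = 3.
  by rewrite /K setUC cardsU1 sK0 /K0 cards2 eq_sym twin_neq.
have vK : v \in K by rewrite in_setU vK0.
have tK : (twin v : BH n.+1) \in K by rewrite in_setU tK0.
have sK : s \in K by rewrite in_setU in_set1 eqxx orbT.
have dK : 4 <= degsum K.
  have := degsum_setU_nbrs (ltnW n2) vK0 tK0 dis; rewrite cards1 muln1 => h.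
  by apply: leq_trans (h _); [apply: leq_addl | move=> x; rewrite inE => /eqP->].
have [||||F gF FB] := @core_cut n.+1 g K v isT gn _ vK tK; rewrite ?cK //.
- have c1 : connect (fun x y => [&& x \in K, y \in K & adj x y]) v s.
    by apply: connect1; rewrite vK sK.
  move=> u; rewrite in_setU => /orP[|]; rewrite !inE; last by move/eqP->.
  case/orP => /eqP->; first exact: connect0.
  by apply: connect_trans c1 (connect1 _); rewrite sK tK /= bh_adj_sym.
- apply: leq_trans n2; apply: leq_trans (_ : #|K0| <= 2); last first.
    by rewrite cards2; case: (_ != _).
  apply: subset_leq_card; apply/subsetP => x; rewrite inE in_setU => /andP[/orP[//|]].
  by rewrite in_set1 => /eqP->; rewrite ps; case: (parity v).
- rewrite (_ : [set _ in _ | _] = set0) ?cards0 ?addn0 //.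
  apply/setP => x; rewrite [RHS]inE; apply/negP; rewrite inE => /andP[].
  rewrite inE in_setU in_set1 => /andP[/orP[|/eqP->]]; last by rewrite vs.
  by rewrite !inE => /orP[]/eqP->; rewrite ?parity_twin; case: (parity v).
exists F => //; apply: leq_trans FB; rewrite -addnA leq_add2l.
apply: leq_trans (leq_add dK (leqnn _)).
by rewrite cK; move: g2; clear; case: g => [|[|g]] // _; rewrite !subSS !subn0 mulnS.
Qed.

(** * The denser core over a hexagon *)

Definition hexvec n (t : 'Z_4 * 'Z_4 * 'Z_4) : BH n :=
  [tuple nth 0%R [:: t.1.1; t.1.2; t.2] j | j < n].

Lemma hexvec_nth n t j : 3 <= n -> ((hexvec n t)`_j = [:: t.1.1; t.1.2; t.2]`_j)%R.
Proof.
move=> n3; case: (ltnP j n) => jn.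
  by rewrite -(tnth_nth 0%R _ (Ordinal jn)) tnth_mktuple.
by rewrite !nth_default ?size_tuple //=; apply: leq_trans jn.
Qed.

Lemma parity_hexvec n t : 3 <= n -> parity (hexvec n t) = odd t.1.1.
Proof. by move=> n3; rewrite /parity hexvec_nth. Qed.

Lemma hexvec_inj n : 3 <= n -> injective (hexvec n).
Proof.
move=> n3 [[a b] c] [[a' b'] c'] E.
have E' j : ((hexvec n (a, b, c))`_j = (hexvec n (a', b', c'))`_j)%R by rewrite E.
by have := E' 0; have := E' 1; have := E' 2; rewrite !hexvec_nth //= => -> -> ->.
Qed.

(** Adjacency from an even to an odd vertex on the first three coordinates, in a form that computes.
    The entries a_0 need only their parities, since an even and an odd element of Z_4 always differ
    by 1 or -1. *)
Definition hexarc (t u : 'Z_4 * 'Z_4 * 'Z_4) : bool :=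
  [&& ~~ odd t.1.1, odd u.1.1 &
   [|| (u.1.2 == t.1.2) && (u.2 == t.2),
       (u.1.2 == t.1.2 + 1)%R && (u.2 == t.2) |
       (u.1.2 == t.1.2) && (u.2 == t.2 + 1)%R]].

Definition hexadj t u := hexarc t u || hexarc u t.

Lemma hexarc_adj n t u : 3 <= n -> hexarc t u -> bh_adj (hexvec n t) (hexvec n u).
Proof.
move=> n3 /and3P[te uo tu].
have [s [s1 us]] : exists s, (s == 1%R) || (s == (-1)%R) /\ u.1.1 = (t.1.1 + s)%R.
  move: te uo; case: (t.1.1) => [[|[|[|[|]]]]] // i; case: (u.1.1) => [[|[|[|[|]]]]] // k _ _;
  first [by exists 1%R; split=> //; apply: val_inj | by exists (-1)%R; split=> //; apply: val_inj].
have n0 : 0 < n by apply: leq_trans n3.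
have n1 : 1 < n by apply: leq_trans n3.
have pt : parity (hexvec n t) = false by rewrite parity_hexvec // (negbTE te).
apply/bh_adjP; exists s.
case/or3P: tu => /andP[/eqP u1 /eqP u2];
  [exists (Ordinal n0)|exists (Ordinal n1)|exists (Ordinal n3)]; split=> //;
  apply: eq_from_tnth => j; rewrite !(tnth_nth 0%R) bh_nbr_nat // !hexvec_nth // pt;
  by case: (j : nat) => [|[|[|k]]] /=; rewrite ?u1 ?u2 ?us //; case: k.
Qed.

Lemma hexadj_adj n t u : 3 <= n -> hexadj t u -> bh_adj (hexvec n t) (hexvec n u).
Proof.
by move=> n3 /orP[|] h; [|rewrite bh_adj_sym]; apply: hexarc_adj.
Qed.

(* The classes of a hexagon, in cyclic order starting from that of the center
   0, with multiplicities 2, 2, 1, 1, 2, 2; they span 17 edges. *)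
Definition hexseq : seq ('Z_4 * 'Z_4 * 'Z_4) :=
  [:: (0, 0, 0); (0 + 2, 0, 0); (1, 0, 0); (1 + 2, 0, 0); (0, -1, 0); (1, -1, 1);
      (0, -1, 1); (0 + 2, -1, 1); (1, 0, 1); (1 + 2, 0, 1)]%R.

Lemma hexseq_edges : \sum_(t <- hexseq) \sum_(u <- hexseq) hexadj t u = 34.
Proof. by rewrite unlock; vm_compute. Qed.

(** The core has 10 vertices and degree sum at least 34, and 34 + 4(g + 1 - 10) = 4g - 2, which
    saves 2 over the star. *)
Lemma hex_cut n g : 5 <= n -> 9 <= g < 2 * n ->
  exists2 F : {set {set BH n}}, extra_edge_cut g F & #|F| + 4 * g - 2 <= 2 * n * g.+1.
Proof.
move=> n5 /andP[g9 gn]; have n3 : 3 <= n by apply: leq_trans n5.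
pose K : {set BH n} := [set x in map (hexvec n) hexseq].
have uK : uniq (map (hexvec n) hexseq) by rewrite map_inj_uniq //; apply: hexvec_inj.
have inK t : t \in hexseq -> hexvec n t \in K by move=> tH; rewrite inE map_f.
have cK : #|K| = 10 by rewrite cardsE; move/card_uniqP: uK ->; rewrite size_map.
pose v := hexvec n (0, 0, 0)%R.
have tv : (twin v : BH n) = hexvec n (0 + 2, 0, 0)%R.
  apply: eq_from_tnth => j; rewrite !(tnth_nth 0%R) twin_nth !hexvec_nth //.
  by case: (j : nat) => [|[|[|k]]].
have vK : v \in K by apply: inK.
have tK : (twin v : BH n) \in K by rewrite tv; apply: inK.
have pv : parity v = false by rewrite parity_hexvec.
have dK : 34 <= degsum K.
  rewrite /degsum; under eq_bigr do rewrite card_nbrs.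
  have sumK (f : BH n -> nat) : \sum_(x in K) f x = \sum_(t <- hexseq) f (hexvec n t).
    rewrite -(big_map (hexvec n) xpredT f) (big_uniq _ uK).
    by apply: eq_bigl => x; rewrite inE.
  rewrite sumK -hexseq_edges; apply: leq_sum => t _; rewrite sumK; apply: leq_sum => u _.
  by case: (boolP (hexadj t u)) => // /(hexadj_adj n3) ->.
have [||||F gF FB] := @core_cut n g K v (ltnW (ltnW n3)) gn _ vK tK; rewrite ?cK //.
- pose R (x y : BH n) := [&& x \in K, y \in K & adj x y].
  have step t u : connect R v (hexvec n t) -> t \in hexseq -> u \in hexseq ->
      hexadj t u -> connect R v (hexvec n u).
    move=> vt tH uH tu; apply: connect_trans vt (connect1 _).
    by rewrite /R !inK //=; apply: hexadj_adj.
  have c0 : connect R v (hexvec n (0, 0, 0)%R) by apply: connect0.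
  have c2 := step _ (1, 0, 0)%R c0 isT isT isT.
  have c3 := step _ (1 + 2, 0, 0)%R c0 isT isT isT.
  have c8 := step _ (1, 0, 1)%R c0 isT isT isT.
  have c9 := step _ (1 + 2, 0, 1)%R c0 isT isT isT.
  have c1 := step _ (0 + 2, 0, 0)%R c2 isT isT isT.
  have c4 := step _ (0, -1, 0)%R c2 isT isT isT.
  have c6 := step _ (0, -1, 1)%R c8 isT isT isT.
  have c7 := step _ (0 + 2, -1, 1)%R c8 isT isT isT.
  have c5 := step _ (1, -1, 1)%R c4 isT isT isT.
  move=> u; rewrite inE => /mapP[t]; rewrite /hexseq !inE.
  by do 9?[case/orP]; move/eqP-> => ->.
(* The core has five even vertices, whence n >= 5. *)
- apply: leq_trans (n5); rewrite pv.
  pose s := map (hexvec n) (filter (fun t : 'Z_4 * 'Z_4 * 'Z_4 => ~~ odd t.1.1) hexseq).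
  apply: (@leq_trans (size s)); last by rewrite size_map.
  apply: leq_trans (card_size s); apply: subset_leq_card; apply/subsetP => x.
  rewrite inE [x \in K]inE => /andP[/mapP[t tH ->]]; rewrite parity_hexvec // => pt.
  by apply: map_f; rewrite mem_filter tH andbT; case: odd pt.
(* The only odd vertex of the core not adjacent to v is (1, -1, 1). *)
- apply: leq_trans (n3); rewrite pv (leq_add2l 2 _ 1).
  pose s := map (hexvec n) (filter (fun t : 'Z_4 * 'Z_4 * 'Z_4 =>
    odd t.1.1 && ~~ hexadj (0, 0, 0)%R t) hexseq).
  apply: (@leq_trans (size s)); last by rewrite size_map.
  apply: leq_trans (card_size s); apply: subset_leq_card; apply/subsetP => x.
  rewrite inE [x \in part _ _]inE [x \in K]inE => /andP[/andP[/mapP[t tH ->]]].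
  rewrite parity_hexvec // => pt vt.
  apply: map_f; rewrite mem_filter tH andbT (eqP pt) /=.
  by apply: contra vt; apply: hexadj_adj.
exists F => //; move: FB dK; move: (degsum K) #|F| g9; lia.
Qed.

(** * Assembling the bounds on the connectivity *)

Lemma extra_edge_cut_ge n g (F : {set {set BH n}}) :
    2 <= n -> 2 <= g < threshold n -> extra_edge_cut g F ->
  cut_bound n g.+1 <= #|F|.
Proof.
move=> n2 /andP[g2 gt] /extra_edge_cut_boundary[C [gC Cg]]; apply: leq_trans.
by apply: boundary_ge => //; rewrite ?ltnS ?g2 // addnS.
Qed.

Local Open Scope ring_scope.

Theorem theorem3p6 :
  (forall n g : nat, (1 <= n)%N ->
     (2 <= g <= 8)%N ->
     6 - 12 / (g%:R + 1) <= n%:R :> rat ->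
     exists2 k : nat, extra_edge_connectivity (BH n) g = Some k
       & k%:Z = 2 * (g%:Z + 1) * n%:Z - 4 * g%:Z + 4)
  /\
  (forall n g : nat, (1 <= n)%N ->
     (9 <= g <= 2 * n - 1)%N ->
     3 * (max_induced_edges (BH n) g)%:R / (g%:R + 1) <= n%:R :> rat ->
     exists2 k : nat, extra_edge_connectivity (BH n) g = Some k
       & k%:Z < 2 * (g%:Z + 1) * n%:Z - 4 * g%:Z + 4).
Proof.
split=> n g n_gt0 g_range n_ge.
  (* The rational hypothesis with denominators cleared; since g >= 2, it excludes n = 1. *)
  have ng : (6 * g.+1 <= n * g.+1 + 12)%N.
    have g1 : 0 < g%:R + 1 :> rat by rewrite ltr_wpDl ?ler0n.
    move: n_ge; rewrite lerBlDr -(ler_pM2r g1) [X in _ <= X]mulrDl divfK ?gt_eqF //.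
    by rewrite natr1 -!natrM -natrD ler_nat.
  have [n2 gt gn] : [/\ (2 <= n)%N, (g < threshold n)%N & (g < 2 * n)%N].
    have n2 : (2 <= n)%N by case: n {n_gt0 n_ge} ng => [|[|n]] //; lia.
    have gt : (g < threshold n)%N.
      by case: (threshold_cases n2) => -[nE ->]; move: nE ng g_range; clear; nia.
    split=> //; case: (threshold_cases n2) => -[nE tE]; rewrite tE in gt; lia.
  have g2 : (2 <= g)%N by case/andP: g_range.
  have [F gF FB] : exists2 F : {set {set BH n}}, extra_edge_cut g F
      & (#|F| + 4 * (g - 1) <= 2 * n * g.+1)%N.
    by apply: star_cut => //; rewrite g2 gn.
  have [k kE [kF [F' gF' F'k]]] := extra_edge_connectivity_some gF (leqnn _).
  exists k => //.
  (* Both bounds equal 2n(g+1) - 4(g-1), that is, [cut_bound n g.+1]. *)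
  have := extra_edge_cut_ge n2 (introT andP (conj g2 gt)) gF'.
  rewrite F'k /cut_bound; nia.
(* The range 9 <= g <= 2n - 1 forces n >= 5, as [hex_cut] requires. *)
have [F gF FB] : exists2 F : {set {set BH n}}, extra_edge_cut g F
    & (#|F| + 4 * g - 2 <= 2 * n * g.+1)%N.
  by apply: hex_cut; lia.
have [k kE [kF _]] := extra_edge_connectivity_some gF (leqnn _).
by exists k => //; nia.
Qed.
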